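(* Let $\mathcal{S}=(X,T,X_0,\to,\Sigma,\ell)$ be a finite-state automaton. If $\mathcal{S}$ is $\omega$-$K$-delayed strongly detectable for some $K\in\mathbb{N}$, then $\mathcal{S}$ is also $\omega$-$|X|^2$-delayed strongly detectable.
   Context: A finite-state automaton (FSA) is a sextuple $\mathcal{S}=(X,T,X_0,\to,\Sigma,\ell)$, where $X$ is a finite set of states, $T$ a finite set of events, $X_0\subset X$ a set of initial states, $\to\subset X\times T\times X$ a transition relation, $\Sigma$ a finite set of labels, and $\ell:T\to\Sigma\cup\{\epsilon\}$ a labeling function ($\epsilon$ is the empty word). $\ell$ is extended to finite and infinite event sequences by $\ell(t_1t_2\dots)=\ell(t_1)\ell(t_2)\dots$, $\ell(\epsilon)=\epsilon$. For $s=t_1\cdots t_n\in T^*$, $x\xrightarrow{s}x'$ means that there are states $x=x_0,x_1,\dots,x_n=x'$ with $(x_{i-1},t_i,x_i)\in\to$ for all $i$ (so $x\xrightarrow{\epsilon}x$). For $\sigma_1,\sigma_2\in\Sigma^*$ define the delayed state estimate $$\mathcal{M}(\mathcal{S},\sigma_1,\sigma_2)=\{x\in X\mid \exists x_0\in X_0,\ \exists x'\in X,\ \exists s_1,s_2\in T^*:\ \ell(s_1)=\sigma_1,\ \ell(s_2)=\sigma_2,\ x_0\xrightarrow{s_1}x\xrightarrow{s_2}x'\}.$$ The $\omega$-language $\mathcal{L}^\omega(\mathcal{S})$ is the set of $\sigma\in\Sigma^\omega$ (infinite words) such that $\sigma=\ell(t_1t_2\dots)$ for some infinite event sequence $t_1t_2\dots\in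 T^\omega$ for which there are states $x_0,x_1,\dots$ with $x_0\in X_0$ and $(x_i,t_{i+1},x_{i+1})\in\to$ for all $i\in\mathbb{N}$. Write $\sigma'\sqsubset\sigma$ if the finite word $\sigma'$ is a prefix of $\sigma$. For $K\in\mathbb{N}$, $\mathcal{S}$ is $\omega$-$K$-delayed strongly detectable if there is $k\in\mathbb{N}$ such that for all $\sigma\in\mathcal{L}^\omega(\mathcal{S})$ and all $\sigma_1,\sigma_2\in\Sigma^*$ with $\sigma_1\sigma_2\sqsubset\sigma$: if $|\sigma_1|\ge k$ and $|\sigma_2|\ge K$, then $|\mathcal{M}(\mathcal{S},\sigma_1,\sigma_2)|=1$. *)

(* Defs.v *)
From HB Require Import structures.
From mathcomp Require Import all_boot.
From mathcomp Require Import boolp.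

Set Implicit Arguments.
Unset Strict Implicit.
Unset Printing Implicit Defensive.

(* [lab t = None] encodes the empty label epsilon. *)
Record fsa := Fsa {
  state : finType;
  event : finType;
  init : {set state};
  trans : {set state * event * state};
  label : finType;
  lab : event -> option label
}.

Definition lab_seq (S : fsa) (s : seq (event S)) : seq (label S) :=
  pmap (@lab S) s.

(* Only the values [r 0, ..., r (size s)] are constrained; the events are
   numbered from 0, so that the i-th one leads from [r i] to [r i.+1]. *)
Definition reaches (S : fsa) (x : state S) (s : seq (event S)) (y : state S)
    : Prop :=
  exists r : nat -> state S,
    [/\ r 0 = x, r (size s) = y &
        forall i : 'I_(size s),
          (r i, tnth (in_tuple s) i, r i.+1) \in trans S].

(* Membership is a Prop, made boolean classically, so that [#|_|] applies. *)
Definition delayed_estimate (S : fsa) (s1 s2 : seq (label S))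
    : {set state S} :=
  [set x | `[< exists (x0 x' : state S) (e1 e2 : seq (event S)),
                 [/\ x0 \in init S, lab_seq e1 = s1, lab_seq e2 = s2,
                     reaches x0 e1 x & reaches x e2 x'] >]].

Definition oprefix (A : Type) (w : seq A) (sigma : nat -> A) : Prop :=
  w = mkseq sigma (size w).

(* The infinite word [sigma] is the infinite concatenation
   [lab (t 0) lab (t 1) ...].  Since labels may be empty, this concatenation
   can be finite; the second conjunct says that it is not. *)
Definition is_olabel (S : fsa) (t : nat -> event S) (sigma : nat -> label S)
    : Prop :=
  (forall n, oprefix (lab_seq (mkseq t n)) sigma) /\
  (forall m, exists n, m <= size (lab_seq (mkseq t n))).

Definition olanguage (S : fsa) (sigma : nat -> label S) : Prop :=
  exists t : nat -> event S,
    is_olabel t sigma /\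
    exists r : nat -> state S,
      r 0 \in init S /\ forall i, (r i, t i, r i.+1) \in trans S.

Definition omega_delayed_strongly_detectable (S : fsa) (K : nat) : Prop :=
  exists k : nat, forall sigma : nat -> label S, olanguage sigma ->
    forall s1 s2 : seq (label S), oprefix (s1 ++ s2) sigma ->
      k <= size s1 -> K <= size s2 -> #|delayed_estimate s1 s2| = 1.

(* Main.v *)
Require Import Defs.
From mathcomp Require Import all_boot.
From mathcomp Require Import boolp.

Set Implicit Arguments.
Unset Strict Implicit.
Unset Printing Implicit Defensive.

(** The threshold [k] of delay [K] also works for delay [#|X| ^ 2].  Otherwise
    two distinct states belong to the estimate of some [s1], [s2] with
    [k <= size s1] and [#|X| ^ 2 <= size s2]; follow a run from each of them
    reading [s2].  By pigeonhole the pair of runs visits the same pair of states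
    after two distinct prefixes [u] and [u ++ v] of [s2].  Pumping [v], both
    states belong to the estimate of [s1], [u v^K], while [s1 u v^omega] belongs
    to the omega-language: this contradicts detectability with delay [K]. *)

Section Runs.

Variable S : fsa.
Implicit Types (x y z : state S) (e : seq (event S)) (w : seq (label S)).

(** * Finite runs and the words that they read *)

Lemma reaches_nil x y : reaches x [::] y <-> x = y.
Proof.
split=> [[r [<- <- _]] //|<-].
by exists (fun=> x); split=> // -[].
Qed.

Lemma reaches_cons x a e y :
  reaches x (a :: e) y <-> exists2 z, (x, a, z) \in trans S & reaches z e y.
Proof.
split=> [[r [r0 rn step]]|[z xz [r [r0 rn step]]]].
  exists (r 1); first by rewrite -r0; have := step ord0; rewrite (tnth_nth a).
  exists (fun i => r i.+1); split=> // i.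
  by have := step (lift ord0 i); rewrite !(tnth_nth a).
exists (fun i => if i is j.+1 then r j else x); split=> //.
case=> [[|i] lti]; first by rewrite (tnth_nth a) /= r0.
by have := step (Ordinal (lti : i < size e)); rewrite !(tnth_nth a).
Qed.

Lemma reaches_cat x e1 e2 y :
  reaches x (e1 ++ e2) y <-> exists2 z, reaches x e1 z & reaches z e2 y.
Proof.
elim: e1 x => [|a e1 IH] x /=.
  split=> [xy|[z /reaches_nil-> //]].
  by exists x => //; apply/reaches_nil.
split=> [/reaches_cons[z xz /IH[z' zz' z'y]]|[z' /reaches_cons[z xz zz'] z'y]].
  by exists z' => //; apply/reaches_cons; exists z.
by apply/reaches_cons; exists z => //; apply/IH; exists z'.
Qed.

Lemma lab_seq_cat e1 e2 : lab_seq (e1 ++ e2) = lab_seq e1 ++ lab_seq e2.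
Proof. exact: pmap_cat. Qed.

(** Unlabelled events at the border make the cut ambiguous; the induction cuts as early as possible,
    so they go to [e2]. *)
Lemma lab_seq_split e w1 w2 :
  lab_seq e = w1 ++ w2 ->
  exists e1 e2, [/\ e = e1 ++ e2, lab_seq e1 = w1 & lab_seq e2 = w2].
Proof.
elim: e w1 => [|a e IH] [|b w1] /= => [||<-|].
- by exists [::], [::].
- by [].
- by exists [::], (a :: e).
rewrite /lab_seq /=; case Ea: (lab a) => [c|] /=.
  case=> <- /IH[e1 [e2 [-> <- <-]]]; exists (a :: e1), e2.
  by rewrite /lab_seq /= Ea.
move=> /(IH (b :: w1))[e1 [e2 [-> <- <-]]]; exists (a :: e1), e2.
by rewrite /lab_seq /= Ea.
Qed.

(** Hiding the events absorbs the unlabelled ones, so that runs can be cut and pumped along their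
    words. *)
Definition reads x w y := exists2 e, lab_seq e = w & reaches x e y.

Lemma reads_nil x : reads x [::] x.
Proof. by exists [::] => //; apply/reaches_nil. Qed.

Lemma reads_cat x w1 w2 y :
  reads x (w1 ++ w2) y <-> exists2 z, reads x w1 z & reads z w2 y.
Proof.
split=> [[e /lab_seq_split[e1 [e2 [-> <- <-]]]]|].
  by move=> /reaches_cat[z xz zy]; exists z; [exists e1|exists e2].
case=> z [e1 <- xz] [e2 <- zy]; exists (e1 ++ e2); first exact: lab_seq_cat.
by apply/reaches_cat; exists z.
Qed.

(** One state is chosen per position of the word, not per event. A repeated state at two positions
    then gives a cycle whose label is nonempty. *)
Lemma reads_trace x w y :
  reads x w y ->
  exists2 r : nat -> state S, r 0 = x &
    forall i j, i <= j <= size w -> reads (r i) (drop i (take j w)) (r j).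
Proof.
elim: w x => [|a w IH] x.
  by move=> _; exists (fun=> x) => // i j _; apply: reads_nil.
rewrite -cat1s => /reads_cat[z xz /IH[r r0 rP]].
exists (fun i => if i is j.+1 then r j else x) => // -[|i] [|j] //=.
- by move=> _; apply: reads_nil.
- move=> lej; rewrite -cat1s; apply/reads_cat; exists z => //.
  by rewrite -r0 -[take j w]drop0; apply: rP.
- exact: rP.
Qed.

Lemma delayed_estimateP w1 w2 x :
  reflect (exists x0 x', [/\ x0 \in init S, reads x0 w1 x & reads x w2 x'])
          (x \in delayed_estimate w1 w2).
Proof.
rewrite inE; apply: (iffP (asboolP _)).
  move=> [x0 [x' [e1 [e2 [? ? ? ? ?]]]]]; exists x0, x'.
  by split=> //; [exists e1|exists e2].
by move=> [x0 [x' [? [e1 ? ?] [e2 ? ?]]]]; exists x0, x', e1, e2.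
Qed.

(** * Infinite runs and their words *)

Definition orun x (t : nat -> event S) :=
  exists2 r : nat -> state S, r 0 = x &
    forall i, (r i, t i, r i.+1) \in trans S.

Lemma mkseqD (T : Type) (f : nat -> T) m n :
  mkseq f (m + n) = mkseq f m ++ mkseq (fun i => f (m + i)) n.
Proof. by rewrite /mkseq iotaD map_cat -[0 + m]addn0 iotaDl -map_comp. Qed.

Lemma orun_reaches x t n : orun x t -> exists y, reaches x (mkseq t n) y.
Proof.
case=> r <- step; exists (r n), r; split=> //; first by rewrite size_mkseq.
move=> i; rewrite (tnth_nth (t 0)) nth_mkseq //.
by case: i => i /=; rewrite size_mkseq.
Qed.

Lemma orun_cat x e y t :
  reaches x e y -> orun y t ->
  exists2 t', orun x t' & forall n, mkseq t' (size e + n) = e ++ mkseq t n.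
Proof.
elim: e x => [|a e IH] x; first by move=> /reaches_nil-> yt; exists t.
move=> /reaches_cons[z xz zy] /(IH z zy)[t' [r r0 step] t'E].
exists (fun i => if i is j.+1 then t' j else a).
  exists (fun i => if i is j.+1 then r j else x) => // -[|i] //=.
  by rewrite r0.
by move=> n; rewrite addSn -add1n mkseqD /= t'E.
Qed.

Lemma orun_cycle x e :
  reaches x e x -> e != [::] ->
  exists2 t, orun x t & forall m, mkseq t (m * size e) = flatten (nseq m e).
Proof.
case: e => // a e; set c := a :: e => -[r [r0 rn step]] _.
exists (fun i => nth a c (i %% size c)).
  exists (fun i => r (i %% size c)); first by rewrite mod0n.
  move=> i; have lti : i %% size c < size c by rewrite ltn_mod.
  have := step (Ordinal lti); rewrite (tnth_nth a) /=.
  (* The two indices differ only at the end of a round, where they are [size c] and 0; [r] takes the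
     value [x] at both. *)
  suff -> : r (i %% size c).+1 = r (i.+1 %% size c) by [].
  rewrite -addn1 -[in RHS]addn1 -modnDml.
  have [lt1|] := ltnP ((i %% size c) + 1) (size c).
    by rewrite (modn_small lt1).
  rewrite addn1 => ge1; have -> : (i %% size c).+1 = size c.
    by apply/eqP; rewrite eqn_leq lti.
  by rewrite modnn rn r0.
elim=> [//|m IH].
rewrite mulSn mkseqD -[RHS]/(c ++ flatten (nseq m c)) -IH; congr (_ ++ _).
  rewrite -[RHS](mkseq_nth a c); apply/eq_in_map => i.
  by rewrite mem_iota => /andP[_ lti]; rewrite modn_small.
by apply: eq_mkseq => i; rewrite modnDl.
Qed.

(** The words of the prefixes of [t] extend one another, so letter [i] can be taken from any prefix
    carrying more than [i] labels. *)
Lemma olabel_exists (t : nat -> event S) :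
  (forall m, exists n, m <= size (lab_seq (mkseq t n))) ->
  exists sigma, is_olabel t sigma.
Proof.
move=> unbounded; pose W n := lab_seq (mkseq t n).
(* A default for [nth]: unboundedness forces some label to exist. *)
have [d _] : exists d : label S, True.
  by have [n] := unbounded 1; case: (lab_seq _) => // d _ _; exists d.
have [N ltN] := choice (fun i => unbounded i.+1).
exists (fun i => nth d (W (N i)) i); split=> // n.
have nthW m m' i : m <= m' -> i < size (W m) -> nth d (W m') i = nth d (W m) i.
  by move=> /subnKC<- lti; rewrite /W mkseqD lab_seq_cat nth_cat lti.
apply: (@eq_from_nth _ d); first by rewrite size_mkseq.
move=> i lti; rewrite nth_mkseq //.
have [le|/ltnW le] := leqP n (N i); first by rewrite (nthW n).
exact: nthW le (ltN i).
Qed.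

Lemma oprefix_take (sigma : nat -> label S) w w' :
  oprefix w sigma -> oprefix w' sigma -> size w <= size w' ->
  w = take (size w) w'.
Proof.
move=> -> ->; rewrite !size_mkseq /mkseq -map_take take_iota.
by move=> /minn_idPl->.
Qed.

(** Follow a run of [sigma] until it has read [w1 ++ w2], and perhaps more; its state after [w1] is
    in the estimate. Only uniqueness then remains to be proved for the theorem. *)
Lemma delayed_estimate_neq0 sigma w1 w2 :
  olanguage sigma -> oprefix (w1 ++ w2) sigma -> delayed_estimate w1 w2 != set0.
Proof.
case=> t [[pre unbounded] [r [r0 step]]] w12.
have [n len] := unbounded (size (w1 ++ w2)).
have [|y xy] := @orun_reaches (r 0) t n; first by exists r.
have : reads (r 0) (w1 ++ w2 ++ drop (size (w1 ++ w2)) (lab_seq (mkseq t n))) y.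
  exists (mkseq t n) => //.
  by rewrite catA {1}(oprefix_take w12 (pre n) len) cat_take_drop.
case/reads_cat=> x r0x /reads_cat[x' xx' _].
by apply/set0Pn; exists x; apply/delayed_estimateP; exists (r 0), x'.
Qed.

Lemma reads_pump x v m : reads x v x -> reads x (flatten (nseq m v)) x.
Proof.
move=> xv; elim: m => [|m IH]; first exact: reads_nil.
by apply/reads_cat; exists x.
Qed.

Lemma olanguage_pump x0 x w v :
  x0 \in init S -> reads x0 w x -> reads x v x -> v != [::] ->
  exists2 sigma, olanguage sigma &
    forall m, oprefix (w ++ flatten (nseq m v)) sigma.
Proof.
move=> init0 [e <- x0x] [c <- xx] v_neq0.
have c_neq0 : c != [::] by apply: contra_neq v_neq0 => ->.
have [t xt tE] := orun_cycle xx c_neq0.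
have [t' [r r0 step] t'E] := orun_cat x0x xt.
have labE m : lab_seq (mkseq t' (size e + m * size c)) =
              lab_seq e ++ flatten (nseq m (lab_seq c)).
  rewrite t'E tE lab_seq_cat; congr (_ ++ _).
  by elim: m => //= m <-; rewrite lab_seq_cat.
have [m|sigma sigmaP] := @olabel_exists t'.
  exists (size e + m * size c); rewrite labE size_cat size_flatten.
  rewrite /shape map_nseq sumn_nseq; apply: leq_trans (leq_addl _ _).
  by rewrite leq_pmull // lt0n size_eq0.
exists sigma; first by exists t'; split=> //; exists r; rewrite r0.
by move=> m; rewrite -labE; case: sigmaP.
Qed.

End Runs.

Theorem corollary1 (S : fsa) :
  (exists K : nat, omega_delayed_strongly_detectable S K) ->
  omega_delayed_strongly_detectable S (#|state S| ^ 2).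
Proof.
case=> K [k detK]; exists k => sigma sigmaP s1 s2 pre le1 le2.
apply/eqP; rewrite eqn_leq card_gt0 (delayed_estimate_neq0 sigmaP pre) andbT.
apply/card_le1_eqP => x y /delayed_estimateP[x0 [x' [init_x x0x xx']]].
move=> /delayed_estimateP[y0 [y' [init_y y0y yy']]].
have [r r0 rP] := reads_trace xx'.
have [q q0 qP] := reads_trace yy'.
(* Positions 0 to [#|state S| ^ 2] of [s2] number one more than the pairs of states. *)
pose f (i : 'I_(#|state S| ^ 2).+1) := (r i, q i).
have /injectivePn[i [j ij eqf]] : ~~ injectiveb f.
  apply/injectiveP => /leq_card.
  by rewrite card_ord card_prod -mulnn ltnn.
wlog ltij : i j ij eqf / i < j.
  move=> W; have [|lt|eq] := ltngtP i j; [exact: W| |].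
    by apply: (W j i) => //; rewrite eq_sym.
  by case/eqP: ij; apply: val_inj.
case: eqf => eqr eqq.
have lej : j <= size s2 by apply: leq_trans le2; rewrite -ltnS.
pose u := take i s2; pose v := drop i (take j s2).
have v_neq0 : v != [::].
  by rewrite -size_eq0 size_drop size_takel // subn_eq0 -ltnNge.
have xu : reads x u (r i).
  by rewrite -r0 -[u]drop0; apply: rP; rewrite /= (leq_trans (ltnW ltij)).
have yu : reads y u (q i).
  by rewrite -q0 -[u]drop0; apply: qP; rewrite /= (leq_trans (ltnW ltij)).
(* Only the target becomes [r j], turning the goal into a segment of the trace. *)
have rv : reads (r i) v (r i) by rewrite {2}eqr; apply: rP; rewrite ltnW.
have qv : reads (q i) v (q i) by rewrite {2}eqq; apply: qP; rewrite ltnW.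
(* The run through [x] alone supplies the infinite word; for [y], a finite run reading the pumped
   word will suffice. *)
have [||tau tauP tau_pre] := @olanguage_pump S x0 (r i) (s1 ++ u) v init_x _ rv.
- by apply/reads_cat; exists x.
- exact: v_neq0.
(* [K] copies of the nonempty [v] have length at least [K], and [s1] is still long enough for
   [k]. *)
have /eqP/cards1P[z Mz] : #|delayed_estimate s1 (u ++ flatten (nseq K v))| = 1.
  apply: (detK tau) => //; first by rewrite catA.
  rewrite size_cat size_flatten /shape map_nseq sumn_nseq.
  by apply: leq_trans (leq_addl _ _); rewrite leq_pmull // lt0n size_eq0.
have memM a0 a b :
    a0 \in init S -> reads a0 s1 a -> reads a u b -> reads b v b -> a = z.
  move=> init_a a0a ab bb; apply/set1P; rewrite -Mz; apply/delayed_estimateP.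
  exists a0, b; split=> //; apply/reads_cat; exists b => //.
  exact: reads_pump.
by rewrite (memM _ _ _ init_x x0x xu rv) (memM _ _ _ init_y y0y yu qv).
Qed.
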